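(* Let $\|\cdot\|_F$ be a norm on $\mathbb{R}^2$, and for $x\in\mathbb{R}^2$ let $T_1(x)=\{y\in\mathbb{R}^2:\|x-y\|_F=1\}$. Let $\varepsilon>0$ and let $u,v\in\mathbb{R}^2$ with $1<\|u-v\|_F<2$. Then \[ \chi_{[1-\varepsilon,1+\varepsilon]}\big(T_1(u)\cup T_1(v);F\big)\ \geq\ 4, \] i.e. there is no map $\varphi:T_1(u)\cup T_1(v)\to\{1,2,3\}$ such that $\varphi(x)\ne\varphi(y)$ whenever $x,y\in T_1(u)\cup T_1(v)$ and $\|x-y\|_F\in[1-\varepsilon,1+\varepsilon]$.
   Context: For a set $A\subseteq\mathbb{R}^2$ and a forbidden distance set $\mathcal{D}$, $\chi_{\mathcal{D}}(A;F)$ is the least $k$ such that $A$ admits a map to $\{1,\dots,k\}$ giving different colors to any two points of $A$ whose $\|\cdot\|_F$-distance lies in $\mathcal{D}$. *)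

(* Defs.v *)
From HB Require Import structures.
From mathcomp Require Import all_boot all_order all_algebra.
From mathcomp Require Import all_classical all_reals constructive_ereal ereal.

Set Implicit Arguments.
Unset Strict Implicit.
Unset Printing Implicit Defensive.

Import Order.TTheory GRing.Theory Num.Theory.

Local Open Scope classical_set_scope.
Local Open Scope ring_scope.

(* The plane is 'rV[R]_2; its canonical norm `|x| is the sup norm, so an
   arbitrary norm is an explicit function N. Nonnegativity and N 0 = 0 follow
   from these axioms. *)
Record is_norm (R : realType) (N : 'rV[R]_2 -> R) : Prop := IsNorm {
  is_norm_triangle : forall x y, N (x + y) <= N x + N y;
  is_norm_scale : forall (a : R) x, N (a *: x) = `|a| * N x;
  is_norm_eq0 : forall x, N x = 0 -> x = 0
}.

Definition unit_circle (R : realType) (N : 'rV[R]_2 -> R) (x : 'rV[R]_2) :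
  set 'rV[R]_2 := [set y | N (x - y) = 1].

(* "Any two points" means two distinct points; this only matters when 0 \in D. *)
Definition proper_coloring (R : realType) (N : 'rV[R]_2 -> R) (D : set R)
    (A : set 'rV[R]_2) (k : nat) (phi : A -> 'I_k) : Prop :=
  forall x y : A, x <> y -> D (N (val x - val y)) -> phi x <> phi y.

(* The infimum of a nonempty set of naturals is its least element; the value is
   +oo when no finite number of colors suffices. *)
Definition chromatic_number (R : realType) (N : 'rV[R]_2 -> R) (D : set R)
    (A : set 'rV[R]_2) : \bar R :=
  ereal_inf [set (k%:R)%:E | k in
    [set k : nat | exists phi : A -> 'I_k, proper_coloring N D phi]].

(* Main.v *)
Require Import Defs.
From HB Require Import structures.
From mathcomp Require Import all_boot all_order all_algebra.
From mathcomp Require Import all_classical all_reals constructive_ereal ereal.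
From mathcomp Require Import topology normedtype derive trigo.
From mathcomp Require Import ring lra zify.

(* Put u at the origin and let p be a common point of the two unit circles.
   Along a curve a 3-colouring, sampled finely, lifts from Z/3 to Z with steps
   at most 1. If x and y carry lifted colours h and m and stay at distance
   about 1 while they move, then m - h never becomes a multiple of 3, so
   floor((m - h) / 3) does not change.
   Let r and s be the points of the circle around 0 at distance 1 from p on its
   two sides. Moving the pair (r, p) to (p, s) along that circle shows that
   h(r) - h(p) and h(p) - h(s) have the same floor, hence |h(r) - h(s)| >= 2.
   On the other hand move y from p along the circle around v until its distance
   from 0 is 2, followed by the two points of the circle around 0 at distance 1
   from y: they start at r and s and merge at y / 2, so m - h(r) and m - h(s)
   have the same floor, hence |h(r) - h(s)| <= 1.
   For a norm that is not strictly convex the followers of y need not be unique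
   or continuous, but distances from y along a half circle are monotone, so any
   two choices are joined by an arc of points at distance about 1 from y. *)

Set Implicit Arguments.
Unset Strict Implicit.
Unset Printing Implicit Defensive.

Import Order.TTheory GRing.Theory Num.Theory.
Import numFieldNormedType.Exports.

Local Open Scope classical_set_scope.
Local Open Scope ring_scope.

(** * Continuity and connectedness on the real line *)

Lemma lipschitz_continuous (R : realType) (f : R -> R) (K : R) :
  (forall s t, `|f s - f t| <= K * `|s - t|) -> continuous f.
Proof.
move=> fK t; apply/cvgrPdist_lt => e e0.
have K1 : 0 < `|K| + 1 by rewrite ltr_wpDl.
apply/nbhs_normP; exists (e / (`|K| + 1)) => /=; first by rewrite divr_gt0.
move=> s /= st; apply: le_lt_trans (fK t s) _.
apply: le_lt_trans (_ : (`|K| + 1) * `|t - s| < e).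
  by rewrite ler_wpM2r // (le_trans (ler_norm _)) // lerDl.
by rewrite mulrC -ltr_pdivlMr.
Qed.

(** Connectedness of a segment for a bare predicate: the indicator of [Q], extended to the line by
    clamping to [[a, b]], is continuous, so if [Q b] failed it would take the value 1/2. *)
Lemma locally_constant_segment (R : realType) (Q : R -> Prop) (a b : R) :
  a <= b ->
  (forall t, a <= t <= b -> exists2 d : R, 0 < d &
     forall t', a <= t' <= b -> `|t - t'| < d -> (Q t <-> Q t')) ->
  Q a -> Q b.
Proof.
move=> ab Qloc Qa; apply: contrapT => nQb.
pose k t : R := Num.max a (Num.min b t).
have kab t : a <= k t <= b by rewrite le_max lexx ge_max ab ge_min lexx.
have kL s t : `|k s - k t| <= `|s - t|.
  rewrite ler_norml /k; case: (leP b s); case: (leP b t); case: (leP a b);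
    case: (leP a s); case: (leP a t); case: (ler0P (s - t));
    by move=> *; apply/andP; split; lra.
pose g t : R := if `[< Q (k t) >] then 1 else 0.
have cg : continuous g.
  move=> t; apply: cvg_near_cst; have [d d0 Qd] := Qloc _ (kab t).
  apply/nbhs_normP; exists d => //= s ts.
  rewrite /g; suff -> : `[< Q (k s) >] = `[< Q (k t) >] by [].
  apply: asbool_equiv_eq; apply: iff_sym; apply: Qd => //.
  exact: le_lt_trans (kL _ _) ts.
have ga : g a = 1.
  by rewrite /g /k (min_idPr ab) maxxx; case: asboolP.
have gb : g b = 0.
  by rewrite /g /k minxx (max_idPr ab); case: asboolP.
have [|c _] := @IVT R g a b 2^-1 ab (continuous_subspaceT cg).
  by rewrite ga gb ge_min le_max; apply/andP; split; apply/orP; [right|left]; lra.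
by rewrite /g; case: ifP => _; lra.
Qed.

Lemma cos_lipschitz (R : realType) (s t : R) : `|cos s - cos t| <= `|s - t|.
Proof.
wlog ts : s t / t <= s => [H|].
  by case/orP: (le_total t s) => /H //; rewrite distrC [X in _ <= X]distrC.
have d x : x \in `]t, s[ -> is_derive x 1 cos (- sin x).
  by move=> _; exact: is_derive_cos.
have cf := continuous_subspaceT (@continuous_cos R).
have [c _ ->] := MVT_segment ts d (cf _).
by rewrite normrM ler_piMl // normrN ler_norml sin_geN1 sin_le1.
Qed.

Lemma sin_lipschitz (R : realType) (s t : R) : `|sin s - sin t| <= `|s - t|.
Proof.
wlog ts : s t / t <= s => [H|].
  by case/orP: (le_total t s) => /H //; rewrite distrC [X in _ <= X]distrC.
have d x : x \in `]t, s[ -> is_derive x 1 sin (cos x).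
  by move=> _; exact: is_derive_sin.
have cf := continuous_subspaceT (@continuous_sin R).
have [c _ ->] := MVT_segment ts d (cf _).
by rewrite normrM ler_piMl // ler_norml cos_geN1 cos_le1.
Qed.

(** * Norm inequalities in the plane *)

Section Norm.
Variables (R : realType) (N : 'rV[R]_2 -> R).
Hypothesis hN : is_norm N.
Implicit Types x y z : 'rV[R]_2.

Lemma norm0 : N 0 = 0.
Proof. by rewrite -(scale0r 0) (is_norm_scale hN) normr0 mul0r. Qed.

Lemma normN x : N (- x) = N x.
Proof. by rewrite -scaleN1r (is_norm_scale hN) normrN1 mul1r. Qed.

Lemma norm_distC x y : N (x - y) = N (y - x).
Proof. by rewrite -normN opprB. Qed.

Lemma norm_ge0 x : 0 <= N x.
Proof.
have := is_norm_triangle hN x (- x).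
by rewrite subrr norm0 normN; lra.
Qed.

Lemma norm_gt0 x : x != 0 -> 0 < N x.
Proof.
move=> x0; rewrite lt_def norm_ge0 andbT.
by apply: contraNneq x0 => /(is_norm_eq0 hN) ->.
Qed.

Lemma norm_scale_ge0 (a : R) x : 0 <= a -> N (a *: x) = a * N x.
Proof. by move=> a0; rewrite (is_norm_scale hN) ger0_norm. Qed.

Lemma norm_dist_triangle y x z : N (x - z) <= N (x - y) + N (y - z).
Proof. by rewrite -[x - z](subrKA y) (is_norm_triangle hN). Qed.

Lemma norm_reverse_triangle x y : `|N x - N y| <= N (x - y).
Proof.
have := is_norm_triangle hN (x - y) y; have := is_norm_triangle hN (y - x) x.
rewrite !subrK (norm_distC y x) => h1 h2.
by rewrite ler_norml; apply/andP; split; lra.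
Qed.

(* When the segments [0, x1] and [r e, x2] cross, the two diagonals of the
   quadrilateral 0, r e, x1, x2 are together at least as long as the opposite
   sides [0, x2] and [r e, x1]; otherwise r e is far away from the circle. *)
Lemma norm_cone_monotone (e x1 x2 : 'rV[R]_2) (r a b : R) :
  N e = 1 -> N x1 = 1 -> N x2 = 1 -> 0 <= r -> 0 <= a -> 0 <= b ->
  x1 = a *: e + b *: x2 -> N (r *: e - x1) <= N (r *: e - x2).
Proof.
move=> ne n1 n2 r0 a0 b0 def1.
have ab1 : 1 <= a + b.
  rewrite -n1 def1; apply: le_trans (is_norm_triangle hN _ _) _.
  by rewrite !norm_scale_ge0 // ne n2; lra.
have y2 : r - 1 <= N (r *: e - x2).
  have := norm_reverse_triangle (r *: e) x2.
  by rewrite norm_scale_ge0 // ne n2 mulr1; apply: le_trans; exact: ler_norm.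
have [ra|ar] := leP (r * (1 - b)) a; last first.
  have b1 : b < 1.
    by rewrite ltNge; apply/negP => b1; nra.
  have -> : r *: e - x1 = b *: (r *: e - x2) + (r * (1 - b) - a) *: e.
    by rewrite def1; apply/rowP => i; rewrite !mxE; ring.
  apply: le_trans (is_norm_triangle hN _ _) _.
  rewrite !norm_scale_ge0 // ?ne; last by lra.
  by nra.
have [r00|rpos] := eqVneq r 0.
  by rewrite r00 !scale0r !sub0r !normN n1 n2.
have {rpos} rpos : 0 < r by rewrite lt_def rpos.
have D0 : 0 < a + b * r by nra.
(* [k *: x1] is the crossing point of the segments: [e1] and [e2] below place it on [[r *: e, x2]],
   and [k <= 1] on [[0, x1]]. *)
pose k := r / (a + b * r).
have kab : k * (a + b * r) = r by rewrite /k divfK // gt_eqF.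
have k0 : 0 <= k by rewrite divr_ge0 // ltW.
have k1 : k <= 1 by rewrite ler_pdivrMr // mul1r; lra.
have kb : k * b <= 1.
  by rewrite /k mulrAC ler_pdivrMr // mul1r; nra.
have kb0 : 0 <= k * b by rewrite mulr_ge0.
have ka : k * a = r * (1 - k * b) by lra.
have e1 : r *: e - k *: x1 = (k * b) *: (r *: e - x2).
  rewrite def1; apply/rowP => i; rewrite !mxE.
  have -> : k * (a * e ord0 i + b * x2 ord0 i) =
     (k * a) * e ord0 i + k * b * x2 ord0 i by ring.
  by rewrite ka; ring.
have e2 : k *: x1 - x2 = (1 - k * b) *: (r *: e - x2).
  rewrite def1; apply/rowP => i; rewrite !mxE.
  have -> : k * (a * e ord0 i + b * x2 ord0 i) =
     (k * a) * e ord0 i + k * b * x2 ord0 i by ring.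
  by rewrite ka; ring.
have h1 := norm_dist_triangle (k *: x1) (r *: e) x1.
have h2 := norm_dist_triangle (k *: x1) x2 0.
rewrite !subr0 n2 norm_scale_ge0 // n1 (norm_distC x2) e2 in h2.
have e3 : k *: x1 - x1 = - ((1 - k) *: x1).
  by apply/rowP => i; rewrite !mxE; ring.
rewrite e1 e3 normN in h1.
rewrite norm_scale_ge0 in h2; last by lra.
rewrite !norm_scale_ge0 ?n1 // in h1; last by lra.
by lra.
Qed.

End Norm.

(** * Angular parametrisation of the unit circle and distances along it *)

Section Circle.
Variables (R : realType) (N : 'rV[R]_2 -> R).
Hypothesis hN : is_norm N.
Variables (e1 e2 : 'rV[R]_2).
Hypothesis e12_free : forall a b : R, a *: e1 + b *: e2 = 0 -> a = 0 /\ b = 0.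

Definition ellipse (s : R) : 'rV[R]_2 := cos s *: e1 + sin s *: e2.

(** Radial projection of the ellipse to norm 1; the parameter is the angle in the basis [e1],
    [e2]. *)
Definition circle (s : R) : 'rV[R]_2 := (N (ellipse s))^-1 *: ellipse s.

Lemma ellipse_neq0 s : ellipse s != 0.
Proof.
apply/eqP => /e12_free [c0 s0].
by have := cos2Dsin2 s; rewrite c0 s0 expr0n /= addr0 => /esym/eqP; rewrite oner_eq0.
Qed.

Lemma norm_ellipse_gt0 s : 0 < N (ellipse s).
Proof. by rewrite norm_gt0 // ellipse_neq0. Qed.

Lemma norm_circle s : N (circle s) = 1.
Proof.
rewrite /circle norm_scale_ge0 // ?invr_ge0 ?ltW ?norm_ellipse_gt0 //.
by rewrite mulVf // gt_eqF // norm_ellipse_gt0.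
Qed.

Lemma ellipse_lipschitz s t :
  N (ellipse s - ellipse t) <= (N e1 + N e2) * `|s - t|.
Proof.
have -> : ellipse s - ellipse t = (cos s - cos t) *: e1 + (sin s - sin t) *: e2.
  by apply/rowP => i; rewrite !mxE; ring.
apply: le_trans (is_norm_triangle hN _ _) _.
rewrite !(is_norm_scale hN) mulrDl ![_ * `|s - t|]mulrC.
by rewrite lerD // ler_wpM2r ?(norm_ge0 hN) ?cos_lipschitz ?sin_lipschitz.
Qed.

Lemma norm_ellipse_lipschitz s t :
  `|N (ellipse s) - N (ellipse t)| <= (N e1 + N e2) * `|s - t|.
Proof. exact: le_trans (norm_reverse_triangle hN _ _) (ellipse_lipschitz _ _). Qed.

(** The minimum over [[- pi, pi]] is attained, hence positive; any other [s] reduces to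
    [acos (cos s)] up to sign. *)
Lemma norm_ellipse_lower_bound : exists2 m : R, 0 < m & forall s, m <= N (ellipse s).
Proof.
have cf := lipschitz_continuous norm_ellipse_lipschitz.
have pi0 := pi_ge0 R.
have pip : - pi <= pi :> R by lra.
have [c _ cmin] := EVT_min pip (continuous_subspaceT cf (A := _)).
exists (N (ellipse c)); first exact: norm_ellipse_gt0.
move=> s.
have c1 : -1 <= cos s <= 1 by rewrite cos_geN1 cos_le1.
have ca : cos (acos (cos s)) = cos s by apply: acosK; rewrite in_itv.
have sa : sin (acos (cos s)) = `|sin s|.
  by rewrite sin_acos // -sin2cos2 sqrtr_sqr.
have a0 := acos_ge0 c1; have ap := acos_lepi c1.
have [s0|s0] := leP 0 (sin s).
  have -> : ellipse s = ellipse (acos (cos s)).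
    by rewrite /ellipse ca sa ger0_norm.
  by apply: cmin; rewrite in_itv /=; apply/andP; split; lra.
have -> : ellipse s = ellipse (- acos (cos s)).
  by rewrite /ellipse cosN sinN ca sa ltr0_norm // opprK.
by apply: cmin; rewrite in_itv /=; apply/andP; split; lra.
Qed.

Lemma circle_lipschitz :
  exists2 L : R, 0 < L & forall s t, N (circle s - circle t) <= L * `|s - t|.
Proof.
have [m m0 mE] := norm_ellipse_lower_bound.
have N1 := norm_ge0 hN e1; have N2 := norm_ge0 hN e2.
exists (2 * (N e1 + N e2 + 1) / m) => [|s t]; first by rewrite divr_gt0 //; lra.
have ns := norm_ellipse_gt0 s; have nt := norm_ellipse_gt0 t.
(* The first term changes the direction, the second corrects the scale. Both obey the same bound,
   whence the factor 2. *)
have -> : circle s - circle t = (N (ellipse s))^-1 *: (ellipse s - ellipse t)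
   + ((N (ellipse t) - N (ellipse s)) / N (ellipse s)) *: circle t.
  apply/rowP => i; rewrite !mxE.
  by field; rewrite !gt_eqF.
apply: le_trans (is_norm_triangle hN _ _) _.
rewrite 2!(is_norm_scale hN) norm_circle mulr1 normrM.
rewrite [`|_^-1|]gtr0_norm ?invr_gt0 //.
have h1 := norm_ellipse_lipschitz t s; have h2 := ellipse_lipschitz s t.
rewrite [`|t - s|]distrC in h1.
rewrite [X in X + _]mulrC -mulrDl ler_pdivrMr //.
have d0 := normr_ge0 (s - t).
apply: le_trans (_ : 2 * (N e1 + N e2 + 1) * `|s - t| <= _); first by nra.
have mn : 1 <= N (ellipse s) / m by rewrite ler_pdivlMr // mul1r.
have -> : 2 * (N e1 + N e2 + 1) / m * `|s - t| * N (ellipse s) =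
    2 * (N e1 + N e2 + 1) * `|s - t| * (N (ellipse s) / m).
  by field; rewrite gt_eqF.
by rewrite ler_peMr // mulr_ge0 //; lra.
Qed.

Lemma circle_dist_continuous (y : 'rV[R]_2) : continuous (fun s => N (y - circle s)).
Proof.
have [L L0 cL] := circle_lipschitz.
apply: (@lipschitz_continuous _ _ L) => s t.
apply: le_trans (norm_reverse_triangle hN _ _) _.
by rewrite opprB addrC subrKA norm_distC // distrC.
Qed.

Lemma circleDpi s : circle (s + pi) = - circle s.
Proof.
have e : ellipse (s + pi) = - ellipse s.
  by rewrite /ellipse cosDpi sinDpi !scaleNr opprD.
by rewrite /circle e normN // scalerN.
Qed.

Lemma circleBpi s : circle (s - pi) = - circle s.
Proof. by rewrite -[in RHS](subrK pi s) circleDpi opprK. Qed.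

(** The sine rule. For [0 <= w1 <= w2 <= pi] all coefficients are nonnegative, so the middle
    direction lies in the cone of the outer ones; [g] selects the side of [th]. *)
Lemma ellipse_cone (g th w1 w2 : R) : g = 1 \/ g = -1 ->
  sin w2 *: ellipse (th + g * w1) =
  sin (w2 - w1) *: ellipse th + sin w1 *: ellipse (th + g * w2).
Proof.
by case=> ->; apply/rowP => i; rewrite !mxE ?mul1r ?mulN1r ?cosB ?sinB ?cosD ?sinD
  ?cosN ?sinN; ring.
Qed.

Lemma circle_ellipse s : ellipse s = N (ellipse s) *: circle s.
Proof. by rewrite scalerA mulfV ?scale1r // gt_eqF ?norm_ellipse_gt0. Qed.

(** The nearer point lies in the cone of [circle th] and the farther one, so [norm_cone_monotone]
    applies. At [w2 = pi] the cone degenerates and the triangle inequality takes over. *)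
Lemma circle_monotone (g th r w1 w2 : R) : g = 1 \/ g = -1 -> 0 <= r ->
  0 <= w1 -> w1 <= w2 -> w2 <= pi ->
  N (r *: circle th - circle (th + g * w1)) <=
  N (r *: circle th - circle (th + g * w2)).
Proof.
move=> hg r0 w10 w12 w2p.
have [w2pi|w2pi] := eqVneq w2 pi.
  have -> : circle (th + g * w2) = - circle th.
    by rewrite w2pi; case: hg => ->; rewrite ?mul1r ?mulN1r ?circleDpi ?circleBpi.
  have -> : r *: circle th - - circle th = (r + 1) *: circle th.
    by rewrite opprK scalerDl scale1r.
  rewrite norm_scale_ge0 ?addr_ge0 //.
  rewrite norm_circle mulr1; apply: le_trans (is_norm_triangle hN _ _) _.
  by rewrite normN // norm_scale_ge0 // !norm_circle mulr1.
have [w20|w20] := eqVneq w2 0.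
  by have -> : w1 = w2 by lra.
have s2 : 0 < sin w2.
  by apply: sin_gt0_pi; rewrite !lt_def w20 eq_sym w2pi w2p (le_trans w10 w12).
have s1 : 0 <= sin w1 by apply: sin_ge0_pi; apply/andP; split; lra.
have s12 : 0 <= sin (w2 - w1) by apply: sin_ge0_pi; apply/andP; split; lra.
have n0 := norm_ellipse_gt0 th; have n1 := norm_ellipse_gt0 (th + g * w1).
have n2 := norm_ellipse_gt0 (th + g * w2).
apply: (@norm_cone_monotone R N hN _ _ _ r
  (sin (w2 - w1) * N (ellipse th) / (sin w2 * N (ellipse (th + g * w1))))
  (sin w1 * N (ellipse (th + g * w2)) / (sin w2 * N (ellipse (th + g * w1)))));
  rewrite ?norm_circle //.
- by rewrite divr_ge0 // mulr_ge0 // ltW.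
- by rewrite divr_ge0 // mulr_ge0 // ltW.
have h := ellipse_cone th w1 w2 hg.
rewrite (circle_ellipse th) (circle_ellipse (th + g * w1))
  (circle_ellipse (th + g * w2)) in h.
move: (circle th) (circle (th + g * w1)) (circle (th + g * w2)) h => c0 c1 c2.
rewrite !scalerA => h.
apply: (@scalerI _ _ (sin w2 * N (ellipse (th + g * w1)))).
  by rewrite mulf_neq0 // gt_eqF.
by rewrite h scalerDr !scalerA; congr (_ *: _ + _ *: _); field; rewrite !gt_eqF.
Qed.

(** Along the half circle the distance goes from [|r - 1|], at most 1 because [0 <= r <= 2], to
    [r + 1]. *)
Lemma unit_distance_on_half_circle (g th r : R) : g = 1 \/ g = -1 -> 0 <= r <= 2 ->
  exists2 w : R, 0 <= w <= pi & N (r *: circle th - circle (th + g * w)) = 1.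
Proof.
move=> hg /andP[r0 r2]; have pi0 := pi_ge0 R.
pose f w := N (r *: circle th - circle (th + g * w)).
have f0 : f 0 <= 1.
  rewrite /f mulr0 addr0.
  have -> : r *: circle th - circle th = (r - 1) *: circle th.
    by rewrite scalerBl scale1r.
  rewrite (is_norm_scale hN) norm_circle.
  by rewrite mulr1 ler_norml; apply/andP; split; lra.
have fp : 1 <= f pi.
  have -> : f pi = r + 1.
    rewrite /f; have -> : circle (th + g * pi) = - circle th.
      by case: hg => ->; rewrite ?mul1r ?mulN1r ?circleDpi ?circleBpi.
    have -> : r *: circle th - - circle th = (r + 1) *: circle th.
      by rewrite opprK scalerDl scale1r.
    by rewrite norm_scale_ge0 ?addr_ge0 // norm_circle mulr1.
  lra.
have cf : continuous f.
  move=> w; apply: (@continuous_comp _ _ _ (fun w => th + g * w)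
    (fun s => N (r *: circle th - circle s))); last exact: circle_dist_continuous.
  by apply: continuousD; [exact: cst_continuous|apply: continuousM;
    [exact: cst_continuous|exact: cvg_id]].
have [|w] := @IVT R f 0 pi 1 pi0 (continuous_subspaceT cf).
  by rewrite ge_min le_max f0 fp orbT.
by rewrite in_itv /=; exists w.
Qed.

Lemma circle_of_direction (s k : R) (x : 'rV[R]_2) :
  0 < k -> ellipse s = k *: x -> x = N x *: circle s.
Proof.
move=> k0 ex.
have n0 := norm_ellipse_gt0 s.
have x0 : N x != 0.
  by apply: contraTneq n0; rewrite ex norm_scale_ge0 ?ltW // => ->; rewrite mulr0 ltxx.
rewrite /circle ex norm_scale_ge0 ?ltW // !scalerA.
by have -> : N x / (k * N x) * k = 1; [field; rewrite x0 gt_eqF|rewrite scale1r].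
Qed.

Lemma circle_polar (a b : R) : 0 < a ->
  let x := a *: e1 + b *: e2 in
  x = N x *: circle (pi *+ 2 + atan (b / a)).
Proof.
move=> a0 x; set t := atan (b / a).
have [tp tt] := atan_def (b / a); rewrite -/t in tp tt.
have c0 := cos_gt0_pihalf tp.
apply: (@circle_of_direction _ (cos t / a)); first exact: divr_gt0.
have st : sin t = cos t * (b / a).
  by rewrite -tt /tan mulrCA mulfV ?mulr1 // gt_eqF.
rewrite /ellipse [pi *+ 2 + t]addrC cosD2pi sinD2pi st.
apply/rowP => i; rewrite !mxE; field; by rewrite gt_eqF.
Qed.

End Circle.

(** * Lifting residues modulo 3 to integers *)

Lemma mod3_path_lift (c : nat -> int) : exists h : nat -> int,
  forall n, (3 %| h n - c n)%Z /\ `|h n.+1 - h n| <= 1.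
Proof.
(* The increment is the representative in {-1, 0, 1} of [c n - h n'] modulo 3, hence the shift by 1
   before and after the reduction. *)
pose h := fix h n : int :=
  if n is n'.+1 then h n' + ((c n - h n' + 1) %% 3)%Z - 1 else c 0%N.
exists h; elim=> [|n [IH1 IH2]]; split; rewrite /=; lia.
Qed.

(** Non-multiples of 3 separated by a multiple of 3 are at least 2 apart. *)
Lemma divz3_step (m n : int) :
  ~~ (3 %| m)%Z -> ~~ (3 %| n)%Z -> `|m - n| <= 1 -> (m %/ 3)%Z = (n %/ 3)%Z.
Proof. lia. Qed.

(** * Sampled lifts of a colouring along curves *)

Section Lift.
Variables (R : realType) (N : 'rV[R]_2 -> R).
Hypothesis hN : is_norm N.
Variables (A : set 'rV[R]_2) (c : 'rV[R]_2 -> int) (eps : R).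
Hypothesis eps_gt0 : 0 < eps.
Hypothesis c_proper : forall x y, A x -> A y ->
  1 - eps <= N (x - y) <= 1 + eps -> ~~ (3 %| c x - c y)%Z.
Implicit Types (P Q : R -> 'rV[R]_2) (H G : R -> int).

Local Notation near_unit d := (`|d - 1| <= eps / 3).

(* The colouring may oscillate wildly along a curve P, so it is sampled at
   points within eps / 3 of P and the samples are lifted from Z/3 to Z. *)
Record color_lift P H : Prop := ColorLift {
  color_lift_sample : forall s : R, 0 <= s -> exists2 z, A z &
    N (z - P s) <= eps / 3 /\ (3 %| H s - c z)%Z;
  color_lift_step : exists2 d : R, 0 < d & forall s t : R, 0 <= s -> 0 <= t ->
    `|s - t| <= d -> `|H s - H t| <= 1
}.

(** Sampling on a grid of mesh [d], over which [P] moves at most [eps / 3]. Parameters within [d] of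
    each other lie in the same or in neighbouring cells. *)
Lemma color_lift_exists P L : 0 < L -> (forall s, A (P s)) ->
  (forall s t, N (P s - P t) <= L * `|s - t|) -> exists H, color_lift P H.
Proof.
move=> L0 AP PL; pose d : R := eps / 3 / L.
have d0 : 0 < d by rewrite !divr_gt0.
have [h hc] := mod3_path_lift (fun n => c (P (n%:R * d))).
exists (fun s => h (Num.truncn (s / d))); split.
- move=> s s0; exists (P ((Num.truncn (s / d))%:R * d)) => //; split;
    last by have [] := hc (Num.truncn (s / d)).
  have sd : 0 <= s / d by rewrite divr_ge0 // ltW.
  have /andP[h1 h2] := truncn_itv sd.
  apply: le_trans (PL _ _) _; rewrite mulrC -ler_pdivlMr // -/d.
  rewrite ler_pdivlMr // in h1; rewrite ltr_pdivrMr // in h2.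
  rewrite -natr1 mulrDl mul1r in h2.
  by rewrite ler_norml; apply/andP; split; lra.
- exists d => // s t s0 t0 std.
  wlog st : s t s0 t0 std / s <= t => [W|].
    have [st|/ltW ts] := leP s t; first exact: W.
    by rewrite distrC; apply: W => //; rewrite distrC.
  have sd : 0 <= s / d by rewrite divr_ge0 // ltW.
  have td : 0 <= t / d by rewrite divr_ge0 // ltW.
  have m : (Num.truncn (s / d) <= Num.truncn (t / d))%N.
    by apply: le_truncn; rewrite ler_pM2r // invr_gt0.
  have m1 : (Num.truncn (t / d) <= (Num.truncn (s / d)).+1)%N.
    have /andP[_ h2] := truncn_itv sd.
    rewrite truncn_le_nat -natr1; apply: le_lt_trans (_ : s / d + 1 < _).
      rewrite -[X in _ + X](divff (lt0r_neq0 d0)) -mulrDl ler_pM2r ?invr_gt0 //.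
      by move: std; rewrite ler_norml => /andP[]; lra.
    by rewrite ltrD2r.
  move: m; rewrite leq_eqVlt => /orP[/eqP <-|m]; first by rewrite subrr normr0.
  have -> : Num.truncn (t / d) = (Num.truncn (s / d)).+1.
    by apply/eqP; rewrite eqn_leq m1.
  by rewrite distrC; case: (hc (Num.truncn (s / d))).
Qed.

(** The tolerance [eps] is spent in thirds: one for each of the two samples and one for
    [near_unit]. *)
Lemma color_lift_proper P Q H G s t : color_lift P H -> color_lift Q G ->
  0 <= s -> 0 <= t -> near_unit (N (P s - Q t)) -> ~~ (3 %| H s - G t)%Z.
Proof.
move=> [sH _] [sG _] s0 t0 st.
have [x Ax [xP xH]] := sH _ s0; have [y Ay [yQ yG]] := sG _ t0.
suff /c_proper : 1 - eps <= N (x - y) <= 1 + eps by move=> /(_ Ax Ay); lia.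
have h1 := norm_dist_triangle hN (P s) x y.
have h2 := norm_dist_triangle hN (Q t) (P s) y.
have h3 := norm_dist_triangle hN x (P s) (Q t).
have h4 := norm_dist_triangle hN y x (Q t).
rewrite (norm_distC hN (Q t)) in h2; rewrite (norm_distC hN (P s) x) in h3.
by move: st; rewrite ler_norml => /andP[h5 h6]; apply/andP; split; lra.
Qed.

Lemma color_lift_step_divz P Q H G s s' t t' : color_lift P H -> color_lift Q G ->
  0 <= s -> 0 <= s' -> 0 <= t -> 0 <= t' ->
  near_unit (N (P s - Q t)) -> near_unit (N (P s' - Q t')) ->
  `|(H s - G t) - (H s' - G t')| <= 1 ->
  ((H s - G t) %/ 3)%Z = ((H s' - G t') %/ 3)%Z.
Proof.
move=> lH lG s0 s0' t0 t0' st st' d.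
by apply: divz3_step => //; exact: (color_lift_proper lH lG).
Qed.

(** One end rests while the other moves. The lifted difference moves in steps of at most 1 and
    avoids multiples of 3, so its quotient is locally constant. *)
Lemma color_lift_segment P Q H G s a b : color_lift P H -> color_lift Q G ->
  0 <= s -> 0 <= a -> a <= b ->
  (forall t, a <= t <= b -> near_unit (N (P s - Q t))) ->
  ((H s - G a) %/ 3)%Z = ((H s - G b) %/ 3)%Z.
Proof.
move=> lH lG s0 a0 ab near.
apply: (@locally_constant_segment R
  (fun t => ((H s - G a) %/ 3)%Z = ((H s - G t) %/ 3)%Z) a b ab) => // t tab.
have [d d0 stepG] := color_lift_step lG; exists d => // t' tab' tt'.
suff -> : ((H s - G t) %/ 3)%Z = ((H s - G t') %/ 3)%Z by [].
have t0 : 0 <= t by case/andP: tab => + _; exact: le_trans.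
have t0' : 0 <= t' by case/andP: tab' => + _; exact: le_trans.
apply: (color_lift_step_divz lH lG) => //; [exact: near|exact: near|].
have -> : H s - G t - (H s - G t') = G t' - G t by ring.
by rewrite distrC; apply: stepG => //; exact: ltW.
Qed.

Lemma color_lift_between P Q H G s a b : color_lift P H -> color_lift Q G ->
  0 <= s -> 0 <= a -> 0 <= b ->
  (forall t, Num.min a b <= t <= Num.max a b -> near_unit (N (P s - Q t))) ->
  ((H s - G a) %/ 3)%Z = ((H s - G b) %/ 3)%Z.
Proof.
move=> lH lG s0 a0 b0; case: (leP a b) => [ab|/ltW ba] near.
  exact: color_lift_segment near.
by apply/esym; exact: color_lift_segment near.
Qed.

End Lift.

(** * Following a moving point around the unit circle *)

Lemma signed_offset_between (R : realType) (g th w w' s : R) :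
  g = 1 \/ g = -1 -> w <= w' ->
  Num.min (th + g * w) (th + g * w') <= s <= Num.max (th + g * w) (th + g * w') ->
  exists2 v : R, w <= v <= w' & s = th + g * v.
Proof.
move=> hg ww'; case: hg => ->.
  rewrite !mul1r; case: (leP (th + w) (th + w')) => ? /andP[h1 h2];
    by exists (s - th); rewrite ?mul1r; try (apply/andP; split); lra.
rewrite !mulN1r; case: (leP (th - w) (th - w')) => ? /andP[h1 h2];
  by exists (th - s); rewrite ?mulN1r; try (apply/andP; split); lra.
Qed.

Section Winding.
Variables (R : realType) (N : 'rV[R]_2 -> R).
Hypothesis hN : is_norm N.
Variables (A : set 'rV[R]_2) (c : 'rV[R]_2 -> int) (eps : R).
Hypothesis eps_gt0 : 0 < eps.
Hypothesis c_proper : forall x y, A x -> A y ->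
  1 - eps <= N (x - y) <= 1 + eps -> ~~ (3 %| c x - c y)%Z.
Variables (e1 e2 : 'rV[R]_2).
Hypothesis e12_free : forall a b : R, a *: e1 + b *: e2 = 0 -> a = 0 /\ b = 0.

Local Notation X := (circle N e1 e2).

(** The bound [r t <= 2] gives every [y t] a follower [X (th t + g * w)] at distance 1, and
    [pi <= th t] keeps its parameter nonnegative. The quotient of the lifted difference is shown to
    be locally constant in [t] for all followers at once. *)
Lemma half_circle_divz_constant (g a b L : R) (y : R -> 'rV[R]_2) (r th : R -> R)
    (G H : R -> int) (wa wb : R) :
  g = 1 \/ g = -1 -> 0 <= a -> a <= b ->
  color_lift N A c eps y G -> color_lift N A c eps X H ->
  (forall s t, N (y s - y t) <= L * `|s - t|) ->
  (forall t, a <= t <= b ->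
     [/\ y t = r t *: X (th t), 0 <= r t <= 2, pi <= th t
       & {for t, continuous th}]) ->
  0 <= wa <= pi -> N (y a - X (th a + g * wa)) = 1 ->
  0 <= wb <= pi -> N (y b - X (th b + g * wb)) = 1 ->
  ((G a - H (th a + g * wa)) %/ 3)%Z = ((G b - H (th b + g * wb)) %/ 3)%Z.
Proof.
move=> hg a0 ab lG lH yL yth wap ya wbp yb.
have e3 : 0 < eps / 3 by rewrite divr_gt0.
have [K K0 XK] := circle_lipschitz hN e12_free.
have [dG dG0 stepG] := color_lift_step lG.
have [dH dH0 stepH] := color_lift_step lH.
have pos (t w : R) : a <= t <= b -> 0 <= w <= pi -> 0 <= th t + g * w.
  by move=> /yth[_ _ tp _] /andP[w0 wp]; case: hg => ->; lra.
have pos0 t : a <= t <= b -> 0 <= t by case/andP => + _; exact: le_trans.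
(* Two followers of the same [y t]: by monotonicity the arc between them stays at distance about 1
   from [y t], so one slides to the other. *)
have row (t w w' : R) : a <= t <= b -> 0 <= w <= pi -> 0 <= w' <= pi ->
    `|N (y t - X (th t + g * w)) - 1| <= eps / 3 ->
    `|N (y t - X (th t + g * w')) - 1| <= eps / 3 ->
    ((G t - H (th t + g * w)) %/ 3)%Z = ((G t - H (th t + g * w')) %/ 3)%Z.
  move=> tab; wlog ww : w w' / w <= w' => [W|].
    case/orP: (le_total w w') => ww wp wp' nw nw'; first exact: W.
    by apply/esym; exact: W.
  move=> wp wp' nw nw'.
  apply: (color_lift_between hN eps_gt0 c_proper lG lH);
    [exact: pos0|exact: pos|exact: pos|].
  move=> s sww.
  have [v vw ->] := signed_offset_between hg ww sww.
  case/andP: vw => wv vw'; case/andP: wp => w0 wp; case/andP: wp' => w0' wp'.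
  have [yt /andP[r0 r2] _ _] := yth _ tab.
  have m1 : N (y t - X (th t + g * w)) <= N (y t - X (th t + g * v)).
    by rewrite yt; apply: circle_monotone => //; lra.
  have m2 : N (y t - X (th t + g * v)) <= N (y t - X (th t + g * w')).
    by rewrite yt; apply: circle_monotone => //; lra.
  move: nw nw'; rewrite !ler_norml => /andP[? ?] /andP[? ?].
  by apply/andP; split; lra.
have zero t : a <= t <= b ->
    exists2 w : R, 0 <= w <= pi & N (y t - X (th t + g * w)) = 1.
  move=> /yth[-> rt _ _]; exact: unit_distance_on_half_circle.
have near1 (d : R) : d = 1 -> `|d - 1| <= eps / 3.
  by move=> ->; rewrite subrr normr0 ltW.
(* Ranging over all followers at time [t] replaces a continuous choice of one. *)
pose Q t := forall w : R, 0 <= w <= pi -> N (y t - X (th t + g * w)) = 1 ->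
  ((G a - H (th a + g * wa)) %/ 3)%Z = ((G t - H (th t + g * w)) %/ 3)%Z.
have Qa : Q a.
  by move=> w wp ya'; apply: row => //; rewrite ?lexx ?near1.
suff Qb : Q b by exact: Qb.
apply: (locally_constant_segment ab _ Qa) => t tab.
have [_ _ _ /cvgrPdist_lt thc] := yth _ tab.
(* The point [y] and its follower at fixed offset may each move by [eps / 6], together [eps / 3],
   while each lift changes by at most 1. *)
pose q : R := Num.min dH (eps / 6 / K).
have q0 : 0 < q by rewrite lt_min dH0 divr_gt0 // divr_gt0.
have /nbhs_normP[d1 /= d10 thd] := thc _ q0.
pose d : R := Num.min d1 (Num.min dG (eps / 6 / (`|L| + 1))).
have L1 : 0 < `|L| + 1 by rewrite ltr_wpDl.
have d0 : 0 < d by rewrite !lt_min d10 dG0 !divr_gt0.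
exists d => // t' tab' tt'.
(* Three moves from [t] to [t']: first [y] alone, then the follower at fixed offset [w], then the
   follower along the circle from [w] to [w']. *)
have main (w w' : R) : 0 <= w <= pi -> N (y t - X (th t + g * w)) = 1 ->
    0 <= w' <= pi -> N (y t' - X (th t' + g * w')) = 1 ->
    ((G t - H (th t + g * w)) %/ 3)%Z = ((G t' - H (th t' + g * w')) %/ 3)%Z.
  move=> wp yw wp' yw'.
  move: tt'; rewrite !lt_min => /and3P[td1 tdG tdL].
  have /ltW := thd _ td1; rewrite le_min => /andP[thH thK].
  have yy : N (y t - y t') <= eps / 6.
    apply: le_trans (yL _ _) _; apply: le_trans (_ : (`|L| + 1) * `|t - t'| <= _).
      by rewrite ler_wpM2r // (le_trans (ler_norm _)) // lerDl.
    by rewrite mulrC -ler_pdivlMr // ltW.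
  have XX : N (X (th t + g * w) - X (th t' + g * w)) <= eps / 6.
    by apply: le_trans (XK _ _) _; rewrite opprD addrACA subrr addr0 mulrC -ler_pdivlMr.
  have n1 : `|N (y t' - X (th t + g * w)) - 1| <= eps / 3.
    rewrite -[X in _ - X]yw; apply: le_trans (norm_reverse_triangle hN _ _) _.
    have -> : y t' - X (th t + g * w) - (y t - X (th t + g * w)) = - (y t - y t').
      by apply/rowP => i; rewrite !mxE; ring.
    by rewrite normN //; apply: le_trans yy _; lra.
  have n2 : `|N (y t' - X (th t' + g * w)) - 1| <= eps / 3.
    rewrite -[X in _ - X]yw; apply: le_trans (norm_reverse_triangle hN _ _) _.
    have -> : y t' - X (th t' + g * w) - (y t - X (th t + g * w)) =
      (X (th t + g * w) - X (th t' + g * w)) - (y t - y t').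
      by apply/rowP => i; rewrite !mxE; ring.
    apply: le_trans (is_norm_triangle hN _ _) _; rewrite (normN hN).
    by apply: le_trans (lerD XX yy) _; lra.
  have -> : ((G t - H (th t + g * w)) %/ 3)%Z = ((G t' - H (th t + g * w)) %/ 3)%Z.
    apply: (color_lift_step_divz hN eps_gt0 c_proper lG lH);
      [exact: pos0|exact: pos0|exact: pos|exact: pos|exact: near1|exact: n1|].
    have -> : G t - H (th t + g * w) - (G t' - H (th t + g * w)) = G t - G t' by ring.
    by apply: stepG; [exact: pos0|exact: pos0|exact: ltW].
  have -> : ((G t' - H (th t + g * w)) %/ 3)%Z = ((G t' - H (th t' + g * w)) %/ 3)%Z.
    apply: (color_lift_step_divz hN eps_gt0 c_proper lG lH);
      [exact: pos0|exact: pos0|exact: pos|exact: pos|exact: n1|exact: n2|].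
    have -> : G t' - H (th t + g * w) - (G t' - H (th t' + g * w)) =
      H (th t' + g * w) - H (th t + g * w) by ring.
    rewrite distrC; apply: stepH; [exact: pos|exact: pos|].
    by rewrite opprD addrACA subrr addr0.
  by apply: row => //; exact: near1.
split=> Qt.
  by move=> w' wp' yw'; have [w wp yw] := zero _ tab; rewrite (Qt w) // (main w w').
by move=> w wp yw; have [w' wp' yw'] := zero _ tab'; rewrite (Qt w') // (main w w').
Qed.

End Winding.

(** With q the first common quotient, [h - s] is 6q + 2, 6q + 3 or 6q + 4, so [|h - s| >= 2]; the
    second equality forces [|h - s| <= 1]. *)
Lemma no_odd_winding (h p s m : int) :
  ~~ (3 %| h - p)%Z -> ~~ (3 %| p - s)%Z -> ~~ (3 %| m - h)%Z -> ~~ (3 %| m - s)%Z ->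
  ((h - p) %/ 3)%Z = ((p - s) %/ 3)%Z -> ((m - h) %/ 3)%Z = ((m - s) %/ 3)%Z -> False.
Proof. lia. Qed.

(** * The contradiction for the circles around 0 and [e1], with common point [e1 + e2] *)

Section Core.
Variables (R : realType) (N : 'rV[R]_2 -> R).
Hypothesis hN : is_norm N.
Variables (A : set 'rV[R]_2) (c : 'rV[R]_2 -> int) (eps : R).
Hypothesis eps_gt0 : 0 < eps.
Hypothesis c_proper : forall x y, A x -> A y ->
  1 - eps <= N (x - y) <= 1 + eps -> ~~ (3 %| c x - c y)%Z.
Variables (e1 e2 : 'rV[R]_2).
Hypotheses (e1_gt1 : 1 < N e1) (e1_lt2 : N e1 < 2).
Hypotheses (e2_unit : N e2 = 1) (e12_unit : N (e1 + e2) = 1).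
Hypothesis A_circles : forall x, N x = 1 \/ N (e1 - x) = 1 -> A x.

(** If [e2 = k *: e1], the unit conditions give [|k| = |1 + k|], so [k = -1/2] and [N e1 = 2], which
    is excluded. *)
Lemma rhombus_free (a b : R) : a *: e1 + b *: e2 = 0 -> a = 0 /\ b = 0.
Proof.
move=> ab0.
have [b0|b0] := eqVneq b 0.
  move: ab0; rewrite b0 scale0r addr0 => /eqP; rewrite scaler_eq0 => /orP[/eqP //|/eqP e10].
  by move: e1_gt1; rewrite e10 norm0 // ltr10.
pose k := - (a / b).
have e2k : e2 = k *: e1.
  apply: (scalerI b0); rewrite scalerA /k mulrN mulrCA mulfV // mulr1 scaleNr.
  by apply/eqP; rewrite -addr_eq0 addrC ab0.
move: e2_unit e12_unit; rewrite e2k -[X in X + _]scale1r -scalerDl.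
rewrite !(is_norm_scale hN); clear ab0 e2k; clearbody k.
move: (N e1) e1_gt1 e1_lt2 => n n1 n2.
by case: (ler0P k) => k0; case: (ler0P (1 + k)) => k1;
  rewrite ?mulNr ?mulrDl ?mul1r => h1 h2;
  exfalso; lra.
Qed.

Local Notation X := (circle N e1 e2).

Lemma circle_at0 : e1 = N e1 *: X 0.
Proof.
apply: (circle_of_direction hN rhombus_free (k := 1)) => //.
by rewrite /ellipse cos0 sin0 scale0r addr0.
Qed.

Lemma circle_atNpihalf : X (- (pi / 2)) = - e2.
Proof.
rewrite /circle; have -> : ellipse e1 e2 (- (pi / 2)) = - e2.
  by rewrite /ellipse cosN sinN cos_pihalf sin_pihalf scale0r add0r scaleN1r.
by rewrite normN // e2_unit invr1 scale1r.
Qed.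

Lemma circle_sampled_lift : exists H, color_lift N A c eps X H.
Proof.
have [L L0 XL] := circle_lipschitz hN rhombus_free.
apply: (color_lift_exists c eps_gt0 L0) => // s; apply: A_circles; left.
exact: norm_circle rhombus_free s.
Qed.

(* The arc of the circle around e1 that starts at the common point e1 + e2 of
   the two circles and moves away from the circle around 0. *)
Definition arc (t : R) : 'rV[R]_2 := e1 - X (- (pi / 2) - t).

Definition arc_norm (t : R) : R := N (arc t).

Definition arc_ellipse_norm (t : R) : R := N (ellipse e1 e2 (- (pi / 2) - t)).

(** The polar angle of [arc t], whose coordinates in the basis [e1], [e2] are the denominator and
    the numerator of this slope. The full turn [pi *+ 2] leaves room to go back by two half circles
    with nonnegative parameters. *)
Definition arc_angle (t : R) : R := pi *+ 2 +
  atan ((cos t / arc_ellipse_norm t) / (1 + sin t / arc_ellipse_norm t)).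

Lemma arc_lipschitz :
  exists2 L : R, 0 < L & forall s t, N (arc s - arc t) <= L * `|s - t|.
Proof.
have [L L0 XL] := circle_lipschitz hN rhombus_free.
exists L => // s t.
have -> : arc s - arc t = X (- (pi / 2) - t) - X (- (pi / 2) - s).
  by apply/rowP => i; rewrite !mxE; ring.
apply: le_trans (XL _ _) _; rewrite ler_pM2l //.
by have -> : - (pi / 2) - t - (- (pi / 2) - s) = s - t by ring.
Qed.

Lemma arc0 : arc 0 = e1 + e2.
Proof. by rewrite /arc subr0 circle_atNpihalf opprK. Qed.

(** The norm of [arc t] is the distance from [e1] to a point running along a half circle that starts
    in the direction of [e1]. It keeps the norm at most 2 until that value is reached. *)
Lemma arc_norm_monotone (s t : R) :
  0 <= s -> s <= t -> t <= pi / 2 -> arc_norm s <= arc_norm t.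
Proof.
move=> s0 st tp.
have arcE v : arc v = N e1 *: X 0 - X (0 + -1 * (pi / 2 + v)).
  by rewrite -circle_at0 /arc add0r mulN1r opprD.
have pi0 := pi_ge0 R.
rewrite /arc_norm !arcE.
by apply: (circle_monotone hN rhombus_free); [right|exact: norm_ge0| | | ]; lra.
Qed.

(** The norm grows from 1 at the common point to [N e1 + 1 > 2] at the point opposite to 0. *)
Lemma arc_reaches_two : exists2 T, 0 <= T <= pi / 2 & arc_norm T = 2.
Proof.
have [L L0 aL] := arc_lipschitz.
have cr : continuous arc_norm.
  apply: (@lipschitz_continuous _ _ L) => s t.
  exact: le_trans (norm_reverse_triangle hN _ _) (aL _ _).
have p0 : 0 <= pi / 2 :> R by rewrite divr_ge0 // pi_ge0.
have r0 : arc_norm 0 = 1 by rewrite /arc_norm arc0.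
have rp : arc_norm (pi / 2) = N e1 + 1.
  rewrite /arc_norm /arc; have -> : - (pi / 2) - pi / 2 = 0 - pi :> R by field.
  rewrite circleBpi // opprK {1}circle_at0.
  have -> : N e1 *: X 0 + X 0 = (N e1 + 1) *: X 0 by rewrite scalerDl scale1r.
  by rewrite norm_scale_ge0 ?addr_ge0 ?norm_ge0 // (norm_circle hN rhombus_free) mulr1.
have [|T] := @IVT R arc_norm 0 (pi / 2) 2 p0 (continuous_subspaceT cr).
  rewrite r0 rp ge_min le_max; apply/andP; split; apply/orP; [left; lra|right].
  by move: (N e1) e1_gt1 => n; lra.
by rewrite in_itv /=; exists T.
Qed.

Lemma arc_polar (t : R) : 0 <= t <= pi / 2 ->
  [/\ arc t = arc_norm t *: X (arc_angle t), pi *+ 2 <= arc_angle t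
    & {for t, continuous arc_angle}].
Proof.
move=> /andP[t0 tp]; have pi0 := pi_ge0 R.
have M0 : 0 < arc_ellipse_norm t.
  exact: (norm_ellipse_gt0 hN rhombus_free).
have st : 0 <= sin t by apply: sin_ge0_pi; apply/andP; split; lra.
have ct : 0 <= cos t by apply: cos_ge0_pihalf; apply/andP; split; lra.
have a0 : 0 < 1 + sin t / arc_ellipse_norm t by rewrite ltr_wpDr // divr_ge0 // ltW.
have arcE : arc t = (1 + sin t / arc_ellipse_norm t) *: e1 +
    (cos t / arc_ellipse_norm t) *: e2.
  rewrite /arc /circle -/(arc_ellipse_norm t) /ellipse.
  have -> : cos (- (pi / 2) - t) = - sin t by rewrite -opprD cosN addrC cosDpihalf.
  have -> : sin (- (pi / 2) - t) = - cos t by rewrite -opprD sinN addrC sinDpihalf.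
  by apply/rowP => i; rewrite !mxE; field; rewrite gt_eqF.
split.
- rewrite /arc_norm /arc_angle {1}arcE [in X in N X]arcE.
  exact: (circle_polar hN rhombus_free).
- rewrite /arc_angle lerDl -(atan0 R); apply: le_atan.
  by rewrite !divr_ge0 // ltW.
have cM : {for t, continuous arc_ellipse_norm}.
  have := lipschitz_continuous (norm_ellipse_lipschitz hN e1 e2).
  move=> /(_ (- (pi / 2) - t)) cN.
  apply: (@continuous_comp _ _ _ (fun t => - (pi / 2) - t)) cN.
  by apply: continuousB; [exact: cst_continuous|exact: cvg_id].
have cMV : {for t, continuous (fun t => (arc_ellipse_norm t)^-1)}.
  by apply: continuousV => //; rewrite gt_eqF.
have c1 : {for t, continuous (fun t => cos t / arc_ellipse_norm t)}.
  by apply: continuousM cMV; exact: continuous_cos.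
have c2 : {for t, continuous (fun t => 1 + sin t / arc_ellipse_norm t)}.
  apply: continuousD; first exact: cst_continuous.
  by apply: continuousM cMV; exact: continuous_sin.
pose slope t := (cos t / arc_ellipse_norm t) / (1 + sin t / arc_ellipse_norm t).
have c3 : {for t, continuous slope}.
  by apply: continuousM c1 _; apply: continuousV c2; rewrite gt_eqF.
apply: continuousD; first exact: cst_continuous.
apply: (@continuous_comp _ _ _ slope (@atan R)) c3 _.
exact: continuous_atan.
Qed.

Lemma two_circles_not_3_colorable : False.
Proof.
have Xunit s : N (X s) = 1 by exact: norm_circle rhombus_free s.
have [H lH] := circle_sampled_lift.
have [L L0 aL] := arc_lipschitz.
have [G lG] : exists G, color_lift N A c eps arc G.
  apply: (color_lift_exists c eps_gt0 L0) => // s; apply: A_circles; right.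
  by rewrite /arc opprB addrC subrK Xunit.
have [K K0 XK] := circle_lipschitz hN rhombus_free.
have [T /andP[T0 Tp] rT] := arc_reaches_two.
have pi0 := pi_ge0 R.
have p2 : 0 <= pi / 2 :> R by rewrite divr_ge0.
have near1 (d : R) : d = 1 -> `|d - 1| <= eps / 3.
  by move=> ->; rewrite subrr normr0 divr_ge0 // ltW.
have r0 : arc_norm 0 = 1 by rewrite /arc_norm arc0.
have [arc0E th0 _] : [/\ arc 0 = arc_norm 0 *: X (arc_angle 0), pi *+ 2 <= arc_angle 0
    & {for 0, continuous arc_angle}] by apply: arc_polar; rewrite lexx.
have [arcTE thT _] : [/\ arc T = arc_norm T *: X (arc_angle T), pi *+ 2 <= arc_angle T
    & {for T, continuous arc_angle}] by apply: arc_polar; rewrite T0.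
rewrite mulr2n in th0 thT.
have arcP t : 0 <= t <= T -> [/\ arc t = arc_norm t *: X (arc_angle t),
    0 <= arc_norm t <= 2, pi <= arc_angle t & {for t, continuous arc_angle}].
  move=> /andP[t0 tT]; have [|h1 h2 h3] := @arc_polar t.
    by rewrite t0 (le_trans tT).
  split => //; first by rewrite norm_ge0 //= -rT arc_norm_monotone.
  by apply: le_trans h2; rewrite mulr2n lerDl.
have r02 : 0 <= arc_norm 0 <= 2 by rewrite r0; apply/andP; split; lra.
(* At radius 2 the midpoint [X (arc_angle T)] is a follower with offset 0 on both sides: here the
   followers merge. *)
have zeroT g : N (arc T - X (arc_angle T + g * 0)) = 1.
  rewrite mulr0 addr0 arcTE rT.
  have -> : 2 *: X (arc_angle T) - X (arc_angle T) = X (arc_angle T); last exact: Xunit.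
  by apply/rowP => i; rewrite !mxE; ring.
(* [ws] and [wr] are the offsets from the common point [arc 0] to its two unit-distance neighbours s
   and r. *)
have [ws wsp zs] := unit_distance_on_half_circle hN rhombus_free (arc_angle 0)
  (or_introl (erefl 1)) r02.
have [wr wrp zr] := unit_distance_on_half_circle hN rhombus_free (arc_angle 0)
  (or_intror (erefl (-1))) r02.
rewrite -arc0E in zs zr.
have W0 : 0 <= (0 : R) <= pi by rewrite lexx.
have Es := half_circle_divz_constant hN eps_gt0 c_proper rhombus_free
  (or_introl (erefl 1)) (lexx 0) T0 lG lH aL arcP wsp zs W0 (zeroT _).
have Er := half_circle_divz_constant hN eps_gt0 c_proper rhombus_free
  (or_intror (erefl (-1))) (lexx 0) T0 lG lH aL arcP wrp zr W0 (zeroT _).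
(* Eliminating the common quotient at [T] compares the pairs ([arc 0], r) and ([arc 0], s). *)
rewrite mul1r mulr0 addr0 in Es; rewrite mulN1r mulr0 addr0 -Es in Er.
rewrite mul1r in zs; rewrite mulN1r in zr.
rewrite arc0E r0 scale1r in zs zr.
case/andP: (wsp) => ws0 ws1; case/andP: (wrp) => wr0 wr1.
(* Both points now run on the circle around 0: the leader from r to [arc 0], the follower from
   [arc 0] to s. *)
have Ep : ((H (arc_angle 0 - wr) - H (arc_angle 0 - wr + 1 * wr)) %/ 3)%Z =
          ((H (arc_angle 0) - H (arc_angle 0 + 1 * ws)) %/ 3)%Z.
  apply: (half_circle_divz_constant hN eps_gt0 c_proper rhombus_free
    (r := fun=> 1) (th := id) (or_introl (erefl 1)) _ _ lH lH XK) => //.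
  - lra.
  - lra.
  - move=> t /andP[t1 t2]; split; last exact: cvg_id.
    + by rewrite scale1r.
    + by apply/andP; split; lra.
    + by rewrite /=; lra.
  - by rewrite mul1r subrK norm_distC.
  - by rewrite mul1r.
rewrite !mul1r subrK in Ep.
(* Here p is [H (arc_angle 0)] and m is [G 0]: lifted colours of the same point along two curves,
   which may differ. *)
apply: (no_odd_winding _ _ _ _ Ep Er).
- by apply: (color_lift_proper hN eps_gt0 c_proper lH lH); [lra|lra|rewrite near1 // norm_distC].
- by apply: (color_lift_proper hN eps_gt0 c_proper lH lH); [lra|lra|rewrite near1].
- apply: (color_lift_proper hN eps_gt0 c_proper lG lH); [by []|lra|].
  by rewrite near1 // arc0E r0 scale1r.
- apply: (color_lift_proper hN eps_gt0 c_proper lG lH); [by []|lra|].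
  by rewrite near1 // arc0E r0 scale1r.
Qed.

End Core.

(** * A common point of the circles, and the passage to arbitrary colourings *)

Lemma exists_rhombus (R : realType) (N : 'rV[R]_2 -> R) (w : 'rV[R]_2) :
  is_norm N -> 1 < N w -> N w < 2 -> exists2 e, N e = 1 & N (w + e) = 1.
Proof.
move=> hN w1 w2.
(* A quarter turn of [w], completing it to a basis. *)
pose z : 'rV[R]_2 := \row_i (if i == 0 then - w 0 1 else w 0 0).
have wz_free a b : a *: w + b *: z = 0 -> a = 0 /\ b = 0.
  move=> abz.
  have q0 : 0 < w 0 0 ^+ 2 + w 0 1 ^+ 2.
    rewrite lt_def addr_ge0 ?sqr_ge0 // andbT paddr_eq0 ?sqr_ge0 // !sqrf_eq0.
    apply/negP => /andP[/eqP h0 /eqP h1].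
    suff w0 : w = 0 by move: w1; rewrite w0 norm0 // ltr10.
    apply/rowP => -[[|[|//]] i2]; rewrite mxE.
      by rewrite -h0; congr (w _ _); exact: val_inj.
    by rewrite -h1; congr (w _ _); exact: val_inj.
  have h0 : a * w 0 0 - b * w 0 1 = 0.
    by have /rowP/(_ 0) := abz; rewrite !mxE /= mulrN.
  have h1 : a * w 0 1 + b * w 0 0 = 0.
    by have /rowP/(_ 1) := abz; rewrite !mxE.
  split; apply: (mulIf (lt0r_neq0 q0)); rewrite mul0r.
    have -> : a * (w 0 0 ^+ 2 + w 0 1 ^+ 2) =
      (a * w 0 0 - b * w 0 1) * w 0 0 + (a * w 0 1 + b * w 0 0) * w 0 1 by ring.
    by rewrite h0 h1 !mul0r addr0.
  have -> : b * (w 0 0 ^+ 2 + w 0 1 ^+ 2) =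
    (a * w 0 1 + b * w 0 0) * w 0 0 - (a * w 0 0 - b * w 0 1) * w 0 1 by ring.
  by rewrite h0 h1 !mul0r subr0.
have wX : w = N w *: circle N w z 0.
  apply: (circle_of_direction hN wz_free (k := 1)) => //.
  by rewrite /ellipse cos0 sin0 scale0r addr0.
have r2 : 0 <= N w <= 2 by rewrite norm_ge0 //= ltW.
(* A unit vector at distance 1 from [w]; it becomes [w + e]. *)
have [s _] := unit_distance_on_half_circle hN wz_free 0 (or_introl (erefl 1)) r2.
rewrite -wX => ws; exists (circle N w z (0 + 1 * s) - w); first by rewrite norm_distC.
by rewrite addrC subrK (norm_circle hN wz_free).
Qed.

Lemma no_proper_3_coloring (R : realType) (N : 'rV[R]_2 -> R) (eps : R)
    (u v : 'rV[R]_2) (k : nat) (phi : (unit_circle N u `|` unit_circle N v) -> 'I_k) :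
  is_norm N -> 0 < eps -> 1 < N (u - v) -> N (u - v) < 2 -> (k <= 3)%N ->
  ~ proper_coloring N `[(1 - eps)%R, (1 + eps)%R] phi.
Proof.
move=> hN eps0; rewrite norm_distC // => w1 w2 k3 col.
pose B := unit_circle N u `|` unit_circle N v.
have [e e_unit we_unit] := exists_rhombus hN w1 w2.
(* Colours become integers below 3, so distinct ones are incongruent modulo 3; 0 is a default off
   the circles. *)
pose c (x : 'rV[R]_2) : int :=
  if pselect (B (u + x)) is left h then Posz (phi (SigSub (mem_set h))) else 0.
pose A : set 'rV[R]_2 := [set x | B (u + x)].
(* The cap 1/2 keeps distances positive, so the points are distinct as [proper_coloring]
   requires. *)
pose d : R := Num.min eps (1 / 2).
have d0 : 0 < d by rewrite lt_min eps0 divr_gt0.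
have dproper x y : A x -> A y ->
    1 - d <= N (x - y) <= 1 + d -> ~~ (3 %| c x - c y)%Z.
  move=> Ax Ay /andP[xy1 xy2]; rewrite /c.
  case: pselect => [hx|] //; case: pselect => [hy|] //.
  have de : d <= eps by rewrite ge_min lexx.
  have d2 : d <= 1 / 2 by rewrite ge_min lexx orbT.
  suff /eqP : phi (SigSub (mem_set hx)) <> phi (SigSub (mem_set hy)).
    move: (phi _) (phi _) => [i ik] [j jk]; rewrite -val_eqE /= => ij.
    by clear -ij ik jk k3; lia.
  apply: col => /=.
    move=> /(congr1 val)/= /addrI xy.
    by move: xy1; rewrite xy subrr norm0 // => ?; lra.
  rewrite opprD addrACA subrr add0r in_itv /=.
  by apply/andP; split; lra.
apply: (@two_circles_not_3_colorable R N hN A c d d0 dproper (v - u) e) => //.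
move=> x; rewrite /A /B /= /unit_circle /= => -[hx|hx]; [left|right].
  by rewrite opprD addrA subrr add0r normN.
by rewrite opprD addrA.
Qed.

Theorem theorem1p2 (R : realType) (N : 'rV[R]_2 -> R) (hN : is_norm N)
    (eps : R) (heps : 0 < eps) (u v : 'rV[R]_2)
    (huv1 : 1 < N (u - v)) (huv2 : N (u - v) < 2) :
  (4%:R%:E <= chromatic_number N `[(1 - eps)%R, (1 + eps)%R]
                (unit_circle N u `|` unit_circle N v))%E
  /\ ~ exists phi : (unit_circle N u `|` unit_circle N v) -> 'I_3,
         forall x y : (unit_circle N u `|` unit_circle N v),
           1 - eps <= N (val x - val y) <= 1 + eps -> phi x <> phi y.
Proof.
split.
  apply/ereal_infP => _ [k [phi col] <-].
  rewrite lee_fin ler_nat leqNgt; apply/negP => k3.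
  exact: (no_proper_3_coloring hN heps huv1 huv2 k3 col).
move=> [phi col]; apply: (@no_proper_3_coloring R N eps u v 3 phi) => //.
by move=> x y _ xy; apply: col; move: xy; rewrite /= in_itv.
Qed.
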